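(* For $z\in\mathbb{C}\setminus\mathbb{Q}(i)$ let $z=[a_0;a_1,a_2,\ldots]$ denote its Hurwitz continued fraction. Then \[ \dim_H \left\{ z=[a_0;a_1,a_2,\ldots]\in\mathbb{C}\setminus\mathbb{Q}(i) : \lim_{n\to\infty}|a_n|=+\infty\right\}=1. \]
   Context: For $z\in\mathbb{C}$ let $[z]=\lfloor \Re z+\tfrac12\rfloor + i\lfloor \Im z+\tfrac12\rfloor\in\mathbb{Z}[i]$. Let $\mathfrak{F}=\{z\in\mathbb{C}: -\tfrac12\le \Re z<\tfrac12,\ -\tfrac12\le \Im z<\tfrac12\}$ and $T:\mathfrak{F}\setminus\{0\}\to\mathfrak{F}$, $T(z)=\frac1z-\left[\frac1z\right]$. For $z\in\mathfrak{F}\setminus\{0\}$ set $z_1=z$, $z_{n+1}=T(z_n)$, $a_0=0$, $a_n=[z_n^{-1}]$ (as long as defined); for irrational $z$ this gives an infinite sequence of nonzero Gaussian integers, the Hurwitz continued fraction (HCF) of $z$, and $z=\lim_n [0;a_1,\ldots,a_n]$. For arbitrary $w\in\mathbb{C}$, its HCF is $(a_n)_{n\ge0}$ with $a_0=[w]$ and $(a_n)_{n\ge1}$ the HCF of $w-a_0$. $\dim_H$ denotes Hausdorff dimension. *)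

(* Defs.v *)
From HB Require Import structures.
From mathcomp Require Export all_boot all_order all_algebra.
From mathcomp Require Export complex.
From mathcomp Require Export all_classical all_reals all_analysis.

Set Implicit Arguments.
Unset Strict Implicit.
Unset Printing Implicit Defensive.

Import Order.TTheory GRing.Theory Num.Theory.
Import numFieldNormedType.Exports.

Local Open Scope classical_set_scope.
Local Open Scope ring_scope.
Local Open Scope complex_scope.

(* The modulus with values in R; the generic norm `|z| is valued in R[i]. *)
Definition cabs (R : realType) (z : R[i]) : R := ComplexField.Normc.normc z.

Definition gauss_round (R : realType) (z : R[i]) : R[i] :=
  (Num.floor (complex.Re z + 2^-1))%:~R +i* (Num.floor (complex.Im z + 2^-1))%:~R.

Definition gauss_rational (R : realType) : set R[i] :=
  [set z | exists p q : rat, z = ratr p +i* ratr q].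

(* Meaningful for z != 0; since 0^-1 = 0, the junk value at 0 is 0. It is never
   reached from z outside gauss_rational. *)
Definition hurwitz_map (R : realType) (z : R[i]) : R[i] :=
  z^-1 - gauss_round z^-1.

(* hcf_remainder w n is the (n+1)-st iterate z_{n+1} attached to w, counted from
   z_1 = w - [w]. *)
Definition hcf_remainder (R : realType) (w : R[i]) (n : nat) : R[i] :=
  iter n (@hurwitz_map R) (w - gauss_round w).

Definition hcf_digit (R : realType) (w : R[i]) (n : nat) : R[i] :=
  if n is m.+1 then gauss_round (hcf_remainder w m)^-1 else gauss_round w.

Section Hausdorff.
Local Open Scope ereal_scope.

(* -oo for the empty set. *)
Definition diameter (R : realType) (U : set R[i]) : \bar R :=
  ereal_sup [set (cabs (x - y))%:E | x in U & y in U].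

(* The separate case makes the empty set weightless also for s = 0, where
   poweR would give 1; a nonempty set has weight 1 for s = 0. *)
Definition diameter_pow (R : realType) (s : R) (U : set R[i]) : \bar R :=
  if U == set0 then 0 else diameter U `^ s.

Definition hausdorff_premeasure (R : realType) (s d : R) (A : set R[i]) :
    \bar R :=
  ereal_inf [set \sum_(0 <= k <oo) diameter_pow s (U k) | U in
    [set U : nat -> set R[i] |
      A `<=` \bigcup_k U k /\ forall k, diameter (U k) <= d%:E]].

Definition hausdorff_measure (R : realType) (s : R) (A : set R[i]) : \bar R :=
  ereal_sup [set hausdorff_premeasure s d A | d in [set d : R | (0 < d)%R]].

Definition hausdorff_dim (R : realType) (A : set R[i]) : \bar R :=
  ereal_inf [set s%:E | s in
    [set s : R | (0 <= s)%R /\ hausdorff_measure s A = 0]].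

End Hausdorff.

(* Main.v *)
Require Import Defs.
From mathcomp Require Import ring lra zify.
Import Order.TTheory GRing.Theory Num.Theory.
Import numFieldNormedType.Exports.
Local Open Scope classical_set_scope.
Local Open Scope ring_scope.
Local Open Scope complex_scope.

Set Implicit Arguments.
Unset Strict Implicit.
Unset Printing Implicit Defensive.

(** Upper bound. Fix [s > 1]. The branch [w |-> 1/(a + w)] of the inverse of [T]
    contracts by at most [4/|a|^2], and the sum of [(4/|a|^2)^s] over the Gaussian
    integers with [|a| >= M] is below [1/2] for [M] large. Hence any cover of the
    set of points all of whose digits have modulus at least [M] induces another one
    of half the weight, so this set is [H^s]-null; the set of the theorem lies in a
    countable union of Lipschitz images of it.

    Lower bound. Fix [s < 1] and let [N_n = N_0 + n]. Replacing the [n]-th digit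
    [d < N_n^2] of the expansion of [t] in [0, 1) to the mixed radix [N_n^2] by the
    Gaussian integer [(N_n + d / N_n) + i (N_n + d mod N_n)] gives a map [g] from
    [0, 1) into the set of the theorem. If the expansions of [t] and [t'] first
    differ at rank [n], then [|t - t'| <= prod_(i < n) N_i^-2], whereas
    [|g t - g t'| >= 1/2 prod_(i <= n) (16 N_i^2)^-1]. As [N_n] grows slowly, this
    gives [|t - t'| <= K |g t - g t'|^s] when [N_0] is large, so that a cover of
    the set pulls back to a cover of [0, 1) and has weight at least [1/(2K)]. *)

(** * Gaussian integers and the Hurwitz map *)

Section Modulus.
Variable R : realType.
Implicit Types (z w : R[i]).

Lemma cabs0 : cabs (0 : R[i]) = 0.
Proof. exact: ComplexField.Normc.normc0. Qed.

Lemma cabs_ge0 z : 0 <= cabs z.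
Proof. by case: z => a b; exact: sqrtr_ge0. Qed.

Lemma cabsM z w : cabs (z * w) = cabs z * cabs w.
Proof. exact: ComplexField.Normc.normcM. Qed.

Lemma cabsV z : cabs z^-1 = (cabs z)^-1.
Proof. exact: ComplexField.Normc.normcV. Qed.

Lemma cabsN z : cabs (- z) = cabs z.
Proof. by case: z => a b; rewrite /cabs /= !sqrrN. Qed.

Lemma cabsD z w : cabs (z + w) <= cabs z + cabs w.
Proof. exact: le_normcD. Qed.

Lemma cabs_distC z w : cabs (z - w) = cabs (w - z).
Proof. by rewrite -cabsN opprB. Qed.

Lemma cabs_eq0 z : (cabs z == 0) = (z == 0).
Proof.
apply/eqP/eqP => [|->]; last exact: cabs0.
exact: ComplexField.Normc.eq0_normc.
Qed.

Lemma cabs_gt0 z : (0 < cabs z) = (z != 0).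
Proof. by rewrite lt_neqAle cabs_ge0 andbT eq_sym cabs_eq0. Qed.

Lemma cabsB_ge z w : cabs z - cabs w <= cabs (z - w).
Proof. by rewrite lerBlDr (le_trans _ (cabsD _ _)) // subrK. Qed.

Lemma cabsD_ge z w : cabs z - cabs w <= cabs (z + w).
Proof. by have := cabsB_ge z (- w); rewrite opprK cabsN. Qed.

Lemma cabs_sqr z : cabs z ^+ 2 = complex.Re z ^+ 2 + complex.Im z ^+ 2.
Proof. by case: z => a b; rewrite sqr_sqrtr // addr_ge0 // sqr_ge0. Qed.

Lemma Re_le_cabs z : `|complex.Re z| <= cabs z.
Proof.
rewrite -(@ler_pXn2r _ 2) ?nnegrE ?cabs_ge0 //.
by rewrite cabs_sqr real_normK ?num_real // lerDl sqr_ge0.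
Qed.

Lemma Im_le_cabs z : `|complex.Im z| <= cabs z.
Proof.
rewrite -(@ler_pXn2r _ 2) ?nnegrE ?cabs_ge0 //.
by rewrite cabs_sqr real_normK ?num_real // lerDr sqr_ge0.
Qed.

Lemma cabs_leD z : cabs z <= `|complex.Re z| + `|complex.Im z|.
Proof.
rewrite -(@ler_pXn2r _ 2) ?nnegrE ?addr_ge0 ?cabs_ge0 //.
rewrite cabs_sqr sqrrD !real_normK ?num_real //.
by rewrite [leRHS]addrAC lerDl mulrn_wge0 // mulr_ge0.
Qed.

(* This identity controls the branches [w |-> (a + w)^-1] in both directions. *)
Lemma cabs_invB z w : z != 0 -> w != 0 ->
  cabs (z^-1 - w^-1) = cabs (z - w) * (cabs z^-1 * cabs w^-1).
Proof.
move=> z0 w0; rewrite -!cabsM cabs_distC; congr cabs.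
by field; rewrite z0 w0.
Qed.

End Modulus.

Section GaussianIntegers.
Variable R : realType.
Implicit Types (z w : R[i]) (m n : int).

Definition gauss_int m n : R[i] := m%:~R +i* n%:~R.

Lemma gauss_intB m n m' n' :
  gauss_int m n - gauss_int m' n' = gauss_int (m - m') (n - n').
Proof. by rewrite /gauss_int !rmorphB. Qed.

Lemma gauss_intM m n m' n' : gauss_int m n * gauss_int m' n' =
  gauss_int (m * m' - n * n') (m * n' + n * m').
Proof. by rewrite /gauss_int !rmorphB !rmorphD !rmorphM. Qed.

Lemma gauss_int_sqr m n : cabs (gauss_int m n) ^+ 2 = (m ^+ 2 + n ^+ 2)%:~R.
Proof. by rewrite cabs_sqr /= rmorphD !rmorphXn. Qed.

Lemma gauss_int_ge1 m n : gauss_int m n != 0 -> 1 <= cabs (gauss_int m n).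
Proof.
rewrite -cabs_gt0 => c0; rewrite -(@ler_pXn2r _ 2) ?nnegrE ?cabs_ge0 //.
rewrite expr1n; have := exprn_gt0 2 c0; rewrite gauss_int_sqr.
by rewrite ltr0z -[1]/(1%:~R) ler_int -gtz0_ge1.
Qed.

Lemma gauss_roundE z : gauss_round z =
  gauss_int (Num.floor (complex.Re z + 2^-1)) (Num.floor (complex.Im z + 2^-1)).
Proof. by []. Qed.

Lemma gauss_round0 : gauss_round (0 : R[i]) = 0.
Proof.
have f0 : Num.floor (0 + 2^-1 : R) = 0.
  by apply/eqP; rewrite floor_eq; apply/andP; split; lra.
by rewrite /gauss_round /= f0.
Qed.

Lemma gauss_round_dist z : cabs (z - gauss_round z) ^+ 2 <= 2^-1.
Proof.
rewrite cabs_sqr; case: z => a b; rewrite /gauss_round /=.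
have sq (x : R) : (x - (Num.floor (x + 2^-1))%:~R) ^+ 2 <= 4^-1.
  have /andP[h1 h2] := floor_itv (x + 2^-1); move: h2; rewrite intrD => h2.
  nra.
have := sq a; have := sq b; lra.
Qed.

Lemma gauss_round_dist_lt1 z : cabs (z - gauss_round z) < 1.
Proof.
have h := gauss_round_dist z; rewrite -(@ltr_pXn2r _ 2) ?nnegrE ?cabs_ge0 //.
by rewrite expr1n (le_lt_trans h) //; lra.
Qed.

(** A tail below 1/2 does not disturb the rounding: this is how prescribed partial quotients are
    recognised as Hurwitz digits. *)
Lemma gauss_round_eq m n w :
  cabs w < 2^-1 -> gauss_round (gauss_int m n + w) = gauss_int m n.
Proof.
move=> hw; have fl (k : int) (x : R) : `|x| < 2^-1 ->
    Num.floor (k%:~R + x + 2^-1) = k.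
  rewrite ltr_norml => /andP[x1 x2].
  by apply/eqP; rewrite floor_eq intrD; apply/andP; split; lra.
case: w hw => a b h; rewrite /gauss_round /gauss_int /=.
rewrite !fl //; apply: le_lt_trans h.
  exact: Im_le_cabs (a +i* b).
exact: Re_le_cabs (a +i* b).
Qed.

Lemma hurwitz_map0 : hurwitz_map (0 : R[i]) = 0.
Proof. by rewrite /hurwitz_map invr0 gauss_round0 subr0. Qed.

(* Euclid's algorithm: [T (p / q)] is a fraction with denominator [p], and
   [|p| < |q|]. *)
Lemma hurwitz_orbit_frac m n m' n' : gauss_int m' n' != 0 ->
  cabs (gauss_int m n / gauss_int m' n') < 1 ->
  exists j, iter j (@hurwitz_map R) (gauss_int m n / gauss_int m' n') = 0.
Proof.
(* The induction runs on a bound for the squared modulus of the denominator. *)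
have [k] : exists k : nat, m' ^+ 2 + n' ^+ 2 < k%:Z.
  by exists `|m' ^+ 2 + n' ^+ 2|.+1; rewrite (le_lt_trans (lez_abs _)) ?ltz_nat.
elim: k m n m' n' => [|k IH] m n m' n' hk q0 h.
  by move: hk; rewrite ltNge addr_ge0 // sqr_ge0.
have [p0|p0] := eqVneq (gauss_int m n) 0.
  by exists 0%N; rewrite /= p0 mul0r.
set x := _ / _ in h *.
have Tx : hurwitz_map x =
    (gauss_int m' n' - gauss_int m n * gauss_round x^-1) / gauss_int m n.
  by rewrite /hurwitz_map /x; field; rewrite p0 q0.
have := gauss_round_dist_lt1 x^-1; rewrite -/(hurwitz_map x) Tx.
move: Tx; rewrite gauss_roundE gauss_intM gauss_intB => Tx hTx.
have [|j hj] := IH _ _ m n _ p0 hTx; last by exists j.+1; rewrite iterSr Tx hj.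
move: h; rewrite cabsM cabsV ltr_pdivrMr ?cabs_gt0 // mul1r.
rewrite -(@ltr_pXn2r _ 2) ?nnegrE ?cabs_ge0 // !gauss_int_sqr ltr_int.
by move=> h; rewrite (lt_le_trans h) // -ltzD1 addrC -intS.
Qed.

(** Over the common denominator [denq p * denq q], Euclid's algorithm applies. The contrapositive
    later keeps constructed points outside Q(i). *)
Lemma gauss_rational_orbit z : gauss_rational z ->
  exists j, hcf_remainder z j = 0.
Proof.
move=> [p [q ->]]; rewrite /hcf_remainder; set z' := _ +i* _.
have D0 (r : rat) : (denq r)%:~R != 0 :> R by rewrite intr_eq0 denq_neq0.
have q0 : gauss_int (denq p * denq q) 0 != 0.
  rewrite -cabs_gt0 -(@ltr_pXn2r _ 2) ?nnegrE ?cabs_ge0 // expr0n.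
  by rewrite gauss_int_sqr ltr0z expr0n addr0 exprn_even_gt0 //= mulf_neq0
    ?denq_neq0.
have zE : z' - gauss_round z' =
    (gauss_int (numq p * denq q) (numq q * denq p) -
     gauss_int (denq p * denq q) 0 * gauss_round z') /
      gauss_int (denq p * denq q) 0.
  have -> : z' = gauss_int (numq p * denq q) (numq q * denq p) /
      gauss_int (denq p * denq q) 0.
    apply: (mulIf q0); rewrite mulfVK // /z' /ratr /gauss_int /= !rmorphM /=.
    by congr (_ +i* _); rewrite ?mulr0 ?subr0 ?add0r; field; rewrite !D0.
  by field.
have := gauss_round_dist_lt1 z'.
rewrite zE gauss_roundE gauss_intM gauss_intB.
exact: hurwitz_orbit_frac.
Qed.

End GaussianIntegers.

(** * Covers and null sets *)

Section Covers.
Variable R : realType.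
Implicit Types (s c : R) (A U : set R[i]) (e : \bar R).

Lemma le_diameter U (x y : R[i]) :
  U x -> U y -> ((cabs (x - y))%:E <= diameter U)%E.
Proof. by move=> Ux Uy; apply: ereal_sup_ubound; exists x => //; exists y. Qed.

Lemma diameter_ge0 U : U !=set0 -> (0 <= diameter U)%E.
Proof.
by move=> [x Ux]; rewrite (le_trans _ (le_diameter Ux Ux)) // lee_fin cabs_ge0.
Qed.

Lemma diameter_pow_ge0 s U : (0 <= diameter_pow s U)%E.
Proof. by rewrite /diameter_pow; case: ifP => // _; exact: poweR_ge0. Qed.

Lemma diameter_pow0 s : diameter_pow s set0 = 0%E.
Proof. by rewrite /diameter_pow eqxx. Qed.

Lemma diameter_pow_le s c U : 0 <= s -> 0 <= c ->
  (forall x y, U x -> U y -> cabs (x - y) <= c) ->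
  (diameter_pow s U <= (c `^ s)%:E)%E.
Proof.
move=> s0 c0 h; rewrite /diameter_pow; case: ifPn => [_|/set0P U0].
  by rewrite lee_fin powR_ge0.
rewrite -poweR_EFin gt0_ler_poweR //.
- by rewrite in_itv /= diameter_ge0 // leey.
- by rewrite in_itv /= lee_fin c0 leey.
by apply: ge_ereal_sup => _ [x Ux [y Uy <-]]; rewrite lee_fin h.
Qed.

Lemma diameter_pow_lipschitz s c (f : R[i] -> R[i]) A U : 0 <= s -> 0 <= c ->
  (forall x y, A x -> A y -> cabs (f x - f y) <= c * cabs (x - y)) ->
  (diameter_pow s (f @` (A `&` U)) <= (c `^ s)%:E * diameter_pow s U)%E.
Proof.
move=> s0 c0 fL; have [->|/set0P[_ [x [Ax Ux] _]]] := eqVneq (f @` (A `&` U)) set0.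
  by rewrite diameter_pow0 mule_ge0 ?diameter_pow_ge0 // lee_fin powR_ge0.
have U0 : U !=set0 by exists x.
rewrite /diameter_pow ifF; last by apply/negbTE/set0P; exists (f x); exists x.
rewrite ifF; last exact/negbTE/set0P.
rewrite -poweR_EFin -poweRM ?diameter_ge0 // gt0_ler_poweR //.
- by rewrite in_itv /= diameter_ge0 ?leey //; exists (f x); exists x.
- by rewrite in_itv /= mule_ge0 ?diameter_ge0 ?leey.
apply: ge_ereal_sup => _ [_ [u [Au Uu] <-] [_ [v [Av Uv] <-] <-]].
apply: (@le_trans _ _ (c * cabs (u - v))%:E); first by rewrite lee_fin fL.
by rewrite EFinM lee_pmul // ?lee_fin ?cabs_ge0 // le_diameter.
Qed.

(** The diameters are left unbounded, as for Hausdorff content: such covers are easier to transport,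
    and by [hnull_measure] arbitrarily small weights still force measure zero when [s > 0]. *)
Definition hcover s A e := exists U : nat -> set R[i],
  A `<=` \bigcup_k U k /\ (\sum_(0 <= k <oo) diameter_pow s (U k) <= e)%E.

Lemma hcover_le s A A' e e' :
  A `<=` A' -> (e' <= e)%E -> hcover s A' e' -> hcover s A e.
Proof.
move=> AA' ee' [U [A'U Ue]]; exists U.
by split; [exact: subset_trans A'U|exact: le_trans ee'].
Qed.

Lemma hcover_self s A : hcover s A (diameter_pow s A).
Proof.
exists (fun k => if k is 0%N then A else set0); split.
  by move=> x Ax; exists 0%N.
rewrite nneseries_recl //=; last by move=> k _; exact: diameter_pow_ge0.
rewrite eseries0 ?adde0 // => -[|k] // _ _; exact: diameter_pow0.
Qed.

Lemma hcover_set0 s : hcover s set0 0%E.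
Proof. by have := hcover_self s set0; rewrite diameter_pow0. Qed.

Lemma hcover_lipschitz s c (f : R[i] -> R[i]) A e : 0 <= s -> 0 <= c ->
  (forall x y, A x -> A y -> cabs (f x - f y) <= c * cabs (x - y)) ->
  hcover s A e -> hcover s (f @` A) ((c `^ s)%:E * e)%E.
Proof.
move=> s0 c0 fL [U [AU Ue]]; exists (fun k => f @` (A `&` U k)); split.
  by move=> _ [x Ax <-]; have [k _ Ux] := AU x Ax; exists k => //; exists x.
apply: (@le_trans _ _ (\sum_(0 <= k <oo) (c `^ s)%:E * diameter_pow s (U k))%E).
  apply: lee_nneseries => k _ *; first exact: diameter_pow_ge0.
  exact: diameter_pow_lipschitz.
rewrite nneseriesZl; last by move=> k _ *; exact: diameter_pow_ge0.
by rewrite lee_wpmul2l // lee_fin powR_ge0.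
Qed.

(** The covers are merged along a bijection between naturals and pairs; nonnegative terms may be
    summed in any order. *)
Lemma hcover_bigcup s (A : nat -> set R[i]) (e : nat -> \bar R) :
  (forall i, hcover s (A i) (e i)) ->
  hcover s (\bigcup_i A i) (\sum_(0 <= i <oo) e i)%E.
Proof.
move=> /choice[U hU].
have /card_esym/ppcard_eqP[f] := card_nat2.
exists (fun k => U (f k).1 (f k).2); split.
  move=> x [i _ Aix]; have [j _ Ux] := (hU i).1 x Aix.
  by exists (f^-1%FUN (i, j)) => //=; rewrite invK ?inE.
have p0 i j : (0 <= diameter_pow s (U i j))%E by exact: diameter_pow_ge0.
rewrite nneseries_esumT //.
rewrite -(@reindex_esum _ _ _ setT setT f (fun k => diameter_pow s (U k.1 k.2))).
  rewrite (_ : setT = setT `*`` (fun=> setT)); last by apply/seteqP; split.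
  rewrite -(@esum_esum _ _ _ setT (fun=> setT) (fun i j => diameter_pow s (U i j))) //.
  rewrite -nneseries_esumT; last by move=> i; apply: esum_ge0.
  apply: lee_nneseries => i _ *; first by apply: esum_ge0.
  by rewrite -nneseries_esumT // (hU i).2.
exact: 'bij_f.
Qed.

Definition hnull s A := forall e : R, 0 < e -> hcover s A e%:E.

Lemma hnull_sub s A A' : A `<=` A' -> hnull s A' -> hnull s A.
Proof. by move=> AA' h e e0; apply: hcover_le (h e e0). Qed.

Lemma hnull_lipschitz s c (f : R[i] -> R[i]) A : 0 <= s -> 0 < c ->
  (forall x y, A x -> A y -> cabs (f x - f y) <= c * cabs (x - y)) ->
  hnull s A -> hnull s (f @` A).
Proof.
move=> s0 c0 fL h e e0; have cs : 0 < c `^ s by exact: powR_gt0.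
apply: (hcover_le (@subset_refl _ _) _
  (hcover_lipschitz s0 (ltW c0) fL (h (e / c `^ s) _))).
  by rewrite -EFinM lee_fin mulrC divfK ?gt_eqF.
exact: divr_gt0.
Qed.

Lemma hnull_bigcup s (A : nat -> set R[i]) :
  (forall i, hnull s (A i)) -> hnull s (\bigcup_i A i).
Proof.
move=> h e e0; apply: (hcover_le (@subset_refl _ _) _
  (hcover_bigcup (fun i => h i (e / (2 ^ i.+1)%:R) _))).
  exact: (epsilon_trick0 xpredT (ltW e0)).
by move=> i; rewrite divr_gt0 // ltr0n expn_gt0.
Qed.

(** Each term is at most the whole sum, so a cover of weight at most [d^s] consists of sets of
    diameter at most [d]: the mesh condition is automatic. *)
Lemma hnull_measure s A : 0 < s -> hnull s A -> hausdorff_measure s A = 0%E.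
Proof.
move=> s0 h; suff H0 d : 0 < d -> hausdorff_premeasure s d A = 0%E.
  rewrite /hausdorff_measure (_ : [set _ | _ in _] = [set 0%E]) ?ereal_sup1 //.
  apply/seteqP; split => [_ [d d0 <-]|_ ->]; first by rewrite /= H0.
  by exists 1 => /=; rewrite ?H0.
move=> d0; apply/eqP; rewrite eq_le; apply/andP; split; last first.
  apply: le_ereal_inf_tmp => _ [U _ <-].
  by apply: nneseries_ge0 => k _ _; exact: diameter_pow_ge0.
apply/lee_addgt0Pr => e e0; rewrite add0e.
pose e' := Num.min e (d `^ s).
have e'0 : 0 < e' by rewrite lt_min e0 powR_gt0.
have [U [AU Ue]] := h e' e'0.
apply: (@le_trans _ _ e'%:E); last by rewrite lee_fin ge_min lexx.
apply: (le_trans _ Ue); apply: ereal_inf_lbound; exists U => //; split=> // k.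
have [->|/set0P U0] := eqVneq (U k) set0.
  rewrite /diameter (_ : [set _ | _ in _ & _ in _] = set0).
    by rewrite ereal_sup0 leNye.
  by apply/seteqP; split=> // y [].
have : (diameter_pow s (U k) <= (d `^ s)%:E)%E.
  apply: (@le_trans _ _ e'%:E); last by rewrite lee_fin ge_min lexx orbT.
  apply: (le_trans _ Ue).
  rewrite (@nneseriesD1 _ _ k) //; last by move=> *; exact: diameter_pow_ge0.
  by rewrite leeDl // nneseries_ge0 // => *; exact: diameter_pow_ge0.
rewrite /diameter_pow ifF; last exact/negbTE/set0P.
have := diameter_ge0 U0; case: (diameter (U k)) => [x| |] //= x0.
  rewrite !lee_fin => xd; rewrite leNgt; apply/negP => dx.
  by have := gt0_ltr_powR s0 _ _ dx; rewrite !nnegrE ltNge xd => /(_ (ltW d0) x0).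
(* An infinite diameter is excluded: its power is infinite because [s] is nonzero. *)
by rewrite gt_eqF.
Qed.

End Covers.

(** * Upper bound *)

Section UpperBound.
Variable R : realType.
Implicit Types (s M : R) (z w a : R[i]).

Lemma pow2_lt1 s : 1 < s -> 2 `^ (1 - s) < 1 :> R.
Proof.
move=> s1; rewrite -opprB powRN invf_lt1 ?powR_gt0 //.
have := @gt0_ltr_powR R (s - 1) _ 1 2; rewrite powR1 /= !nnegrE.
by apply; rewrite ?subr_gt0 //; lra.
Qed.

(* Dyadic blocks: the block [2^k <= n < 2^(k+1)] contributes at most
   [(2^(1-s))^k]. *)
Lemma riemann_dyadic_sum s k : 1 < s ->
  \sum_(1 <= n < 2 ^ k) (n%:R `^ s)^-1 <=
    (1 - (2 `^ (1 - s)) ^+ k) / (1 - 2 `^ (1 - s)) :> R.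
Proof.
move=> s1; set r := 2 `^ (1 - s).
have r1 : r < 1 := pow2_lt1 s1.
elim: k => [|k IH].
  by rewrite expn0 big_geq // expr0 subrr mul0r.
rewrite (@big_cat_nat _ _ _ (2 ^ k)%N) //=; last first.
- by rewrite leq_exp2l.
- by rewrite expn_gt0.
have hb : \sum_(2 ^ k <= n < 2 ^ k.+1) (n%:R `^ s)^-1 <= r ^+ k.
  apply: (@le_trans _ _ (\sum_(2 ^ k <= n < 2 ^ k.+1) ((2 ^ k)%:R `^ s)^-1)).
    apply: ler_sum_nat => n /andP[kn _].
    have h0 : 0 < (2 ^ k)%:R :> R by rewrite ltr0n expn_gt0.
    rewrite lef_pV2 ?posrE ?powR_gt0 //; last by rewrite (lt_le_trans h0) // ler_nat.
    by rewrite ge0_ler_powR ?nnegrE ?ler_nat //; lra.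
  rewrite sumr_const_nat expnS mul2n -addnn addnK -[leLHS]mulr_natr natrX.
  have -> : 2 ^+ k = 2 `^ k%:R :> R by rewrite powR_mulrn.
  rewrite -(powR_mulrn k (powR_ge0 _ _)) /r -!powRrM -powRN -powRD;
    last by apply/implyP.
  by rewrite mulrBl mul1r addrC (mulrC s).
apply: (le_trans (lerD IH hb)).
by rewrite le_eqVlt; apply/orP; left; apply/eqP; rewrite exprS; field; lra.
Qed.

(** Since [n < 2 ^ n], each partial sum is below a dyadic one, itself below the full geometric
    series. *)
Lemma riemann_series_bounded s : 1 < s -> exists2 C : R, 1 <= C &
  (\sum_(0 <= n <oo) (riemannR s n)%:E <= C%:E)%E.
Proof.
move=> s1; set r : R := 2 `^ (1 - s).
have r1 : r < 1 := pow2_lt1 s1.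
have r0 : 0 <= r by exact: powR_ge0.
exists (1 - r)^-1; first by rewrite invf_ge1; lra.
have u0 n : (0 <= (riemannR s n)%:E)%E.
  by rewrite lee_fin ltW // riemannR_gt0 //; lra.
apply: lime_le; first exact: is_cvg_nneseries.
apply: nearW => n; rewrite sumEFin lee_fin.
have -> : \sum_(0 <= i < n) riemannR s i = \sum_(1 <= i < n.+1) (i%:R `^ s)^-1.
  by rewrite big_add1.
apply: (@le_trans _ _ (\sum_(1 <= i < 2 ^ n) (i%:R `^ s)^-1)).
  rewrite [leRHS](@big_cat_nat _ _ _ n.+1) //=; last exact: ltn_expl.
  by rewrite lerDl sumr_ge0 // => i _; rewrite invr_ge0 powR_ge0.
apply: (le_trans (riemann_dyadic_sum n s1)); rewrite -/r.
rewrite ler_pdivrMr; last by lra.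
by rewrite mulVf; [rewrite lerBlDr lerDl exprn_ge0|lra].
Qed.

(** The values run 0, 0, 1, -1, 2, -2, ...; the repeated 0 is harmless for covers, and the modulus
    is [n./2]. *)
Definition int_enum (n : nat) : int :=
  if odd n then - (n./2)%:Z else (n./2)%:Z.

Lemma int_enum_surj k : exists n, int_enum n = k.
Proof.
case: k => k; first by exists k.*2; rewrite /int_enum odd_double doubleK.
exists (k.+1).*2.+1; rewrite /int_enum /= odd_double /= uphalf_double.
by rewrite NegzE.
Qed.

Lemma int_enum_sqr n : int_enum n ^+ 2 = ((n./2) ^ 2)%:Z.
Proof. by rewrite /int_enum; case: ifP => _; rewrite ?sqrrN expr2 -PoszM mulnn. Qed.

Definition gauss_enum (m n : nat) : R[i] := gauss_int R (int_enum m) (int_enum n).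

Lemma gauss_round_enum z : exists m n, gauss_round z = gauss_enum m n.
Proof.
rewrite gauss_roundE.
have [m <-] := int_enum_surj (Num.floor (complex.Re z + 2^-1)).
have [n <-] := int_enum_surj (Num.floor (complex.Im z + 2^-1)).
by exists m, n.
Qed.

(** With [M = m./2] and [N = n./2] not both zero, [(m+1)(n+1) <= 4(M+1)(N+1) <= 16(M^2+N^2)]. This
    lets a sum over Gaussian integers be bounded by a product of two sums over naturals. *)
Lemma gauss_enum_ge m n : gauss_enum m n != 0 ->
  m.+1%:R * n.+1%:R <= 16 * cabs (gauss_enum m n) ^+ 2.
Proof.
rewrite -cabs_gt0 => /(exprn_gt0 2); rewrite /gauss_enum gauss_int_sqr.
rewrite !int_enum_sqr -PoszD ltr0z ltz_nat => h.
rewrite -[_%:~R]/(_%:R) -!natrM ler_nat.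
have := odd_double_half m; have := odd_double_half n.
set M := m./2 in h *; set N := n./2 in h *.
rewrite -!mul2n; move: (leq_b1 (odd m)) (leq_b1 (odd n)) => hm hn eN eM.
have hM : (m.+1 <= 2 * (M + 1))%N by lia.
have hN : (n.+1 <= 2 * (N + 1))%N by lia.
apply: (leq_trans (leq_mul hM hN)).
nia.
Qed.

Lemma hcover_bigcup2 s (A : nat -> nat -> set R[i]) (e : nat -> nat -> \bar R) :
  (forall m n, hcover s (A m n) (e m n)) ->
  hcover s (\bigcup_m \bigcup_n A m n)
    (\sum_(0 <= m <oo) \sum_(0 <= n <oo) e m n)%E.
Proof. by move=> h; apply: hcover_bigcup => m; exact: hcover_bigcup. Qed.

Lemma hurwitz_branch z : z = (gauss_round z^-1 + hurwitz_map z)^-1.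
Proof. by rewrite /hurwitz_map addrC subrK invrK. Qed.

Lemma cabs_gauss_add_ge a w : 2 <= cabs a -> cabs w <= 1 ->
  cabs a / 2 <= cabs (a + w).
Proof. by move=> a2 w1; have := cabsD_ge a w; lra. Qed.

(** Both [|a + x|] and [|a + y|] are at least [|a|/2], and each contributes a factor [2/|a|]. *)
Lemma branch_lipschitz a x y : 2 <= cabs a -> cabs x <= 1 -> cabs y <= 1 ->
  cabs ((a + x)^-1 - (a + y)^-1) <= 4 / cabs a ^+ 2 * cabs (x - y).
Proof.
move=> a2 x1 y1.
have hx := cabs_gauss_add_ge a2 x1; have hy := cabs_gauss_add_ge a2 y1.
have x0 : 0 < cabs (a + x) by lra.
have y0 : 0 < cabs (a + y) by lra.
rewrite cabs_invB -?cabs_gt0 // !cabsV.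
rewrite (_ : a + x - (a + y) = x - y); last by ring.
rewrite mulrC ler_wpM2r ?cabs_ge0 //.
have -> : 4 / cabs a ^+ 2 = (cabs a / 2)^-1 * (cabs a / 2)^-1.
  by field; lra.
by rewrite ler_pM ?invr_ge0 ?cabs_ge0 // lef_pV2 ?posrE; lra.
Qed.

(** The closed unit disc replaces the fundamental square: it contains every remainder, and
    [branch_lipschitz] applies on it. *)
Definition hurwitz_tail M (k : nat) : set R[i] := [set z | cabs z <= 1 /\
  forall n, (k <= n)%N -> M <= cabs (gauss_round (iter n (@hurwitz_map R) z)^-1)].

Lemma hurwitz_tail_map M k z :
  hurwitz_tail M k.+1 z -> hurwitz_tail M k (hurwitz_map z).
Proof.
move=> [_ h]; split; first exact/ltW/gauss_round_dist_lt1.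
by move=> n kn; rewrite -iterSr; exact: h.
Qed.

Lemma hurwitz_tail_weaken M k z : hurwitz_tail M 0 z -> hurwitz_tail M k z.
Proof. by move=> [z1 h]; split => // n _; exact: h. Qed.

Lemma hurwitz_tail_neq0 M k z : 0 < M -> hurwitz_tail M k z -> z != 0.
Proof.
move=> M0 [_ /(_ k (leqnn _))]; apply: contraTneq => ->.
have -> : iter k (@hurwitz_map R) 0 = 0.
  by elim: k => //= k ->; exact: hurwitz_map0.
by rewrite invr0 gauss_round0 cabs0 -ltNge.
Qed.

(* The sum over the branches is at most [4^s 16^s' C^2 M^(-2(s-s'))] where
   [s' = (1+s)/2] and [C] bounds [zeta s']. *)
Lemma branch_weight s : 1 < s -> exists2 M, 2 <= M & exists2 t : R, 0 <= t &
  exists2 C : R, 0 <= C & [/\ t * C * C <= 2^-1,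
    (\sum_(0 <= n <oo) (riemannR ((1 + s) / 2) n)%:E <= C%:E)%E &
    forall m n, M <= cabs (gauss_enum m n) ->
      (4 / cabs (gauss_enum m n) ^+ 2) `^ s <=
        t * riemannR ((1 + s) / 2) m * riemannR ((1 + s) / 2) n].
Proof.
move=> s1; set s' := (1 + s) / 2; have s'1 : 1 < s' by rewrite /s'; lra.
have [C C1 hC] := riemann_series_bounded s'1.
pose d := s - s'; have d0 : 0 < d by rewrite /d /s'; lra.
(* [B] collects the constants and the factor 2 behind the final 1/2; a modulus [x >= M] then
   satisfies [x^2 >= B^(1/d)]. *)
pose B : R := 2 * 4 `^ s * 16 `^ s' * C ^+ 2.
have B0 : 0 < B by rewrite !mulr_gt0 ?powR_gt0 ?exprn_gt0 //; lra.
pose M := 2 + B `^ d^-1.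
have M2 : 2 <= M by rewrite lerDl powR_ge0.
exists M => //; exists (2 * C ^+ 2)^-1; first by rewrite invr_ge0 mulr_ge0 ?sqr_ge0.
exists C; first by lra.
split => //.
  by rewrite le_eqVlt; apply/orP; left; apply/eqP; field; lra.
move=> m n hM; set x := cabs _ in hM *.
have x0 : 0 < x by lra.
have a0 : gauss_enum m n != 0 by rewrite -cabs_gt0.
have hx2 : B <= (x ^+ 2) `^ d.
  have -> : B = (B `^ d^-1) `^ d by rewrite -powRrM mulVf ?powRr1 ?ltW ?gt_eqF.
  rewrite ge0_ler_powR ?nnegrE ?powR_ge0 ?sqr_ge0 ?(ltW d0) //.
  by have : B `^ d^-1 <= x by [rewrite /M in hM; lra]; nra.
have hx3 : (m.+1%:R * n.+1%:R) `^ s' <= 16 `^ s' * (x ^+ 2) `^ s'.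
  rewrite -powRM ?sqr_ge0 //; apply: ge0_ler_powR.
  - lra.
  - by rewrite nnegrE mulr_ge0.
  - by rewrite nnegrE mulr_ge0 ?sqr_ge0.
  exact: gauss_enum_ge.
rewrite powRM ?invr_ge0 ?sqr_ge0 // -powR_inv1 ?sqr_ge0 //.
rewrite -powRrM mulN1r powRN /riemannR.
have -> : (x ^+ 2) `^ s = (x ^+ 2) `^ d * (x ^+ 2) `^ s'.
  rewrite -powRD; last by rewrite expf_eq0 /= (gt_eqF x0) implybT.
  by congr (_ `^ _); rewrite /d; lra.
rewrite powRM ?ler0n // in hx3.
set X := _ `^ d in hx2 *; set Y := (x ^+ 2) `^ s' in hx3 *.
set U := m.+1%:R `^ s' in hx3 *; set V := n.+1%:R `^ s' in hx3 *.
have U0 : 0 < U by rewrite powR_gt0 ?ltr0n.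
have V0 : 0 < V by rewrite powR_gt0 ?ltr0n.
have X0 : 0 < X by rewrite powR_gt0 ?exprn_gt0.
have Y0 : 0 < Y by rewrite powR_gt0 ?exprn_gt0.
have C2 : 0 < C ^+ 2 by rewrite exprn_gt0 //; lra.
have C0 : 0 < C by lra.
have P4 : 0 < 4 `^ s :> R by rewrite powR_gt0.
have -> : (2 * C ^+ 2)^-1 * U^-1 * V^-1 = (2 * C ^+ 2 * (U * V))^-1.
  by rewrite !invfM; ring.
rewrite -[4 `^ s]invrK -invfM lef_pV2 ?posrE ?mulr_gt0 ?invr_gt0 //.
rewrite -(ler_pM2l P4) mulrA [leRHS]mulrA divff ?gt_eqF // mul1r -mulrA.
apply: (@le_trans _ _ (4 `^ s * (2 * C ^+ 2 * (16 `^ s' * Y)))).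
  by rewrite ler_pM2l // ler_pM2l // mulr_gt0.
have -> : 4 `^ s * (2 * C ^+ 2 * (16 `^ s' * Y)) = B * Y by rewrite /B; ring.
by rewrite ler_pM2r.
Qed.

(** Each point of the set is the image of another one under the branch of its first digit. So the
    images of a cover under all branches with [|a| >= M] form a cover, of weight controlled by
    [branch_weight]. *)
Lemma hurwitz_tail_cover_half s : 1 < s -> exists2 M, 2 <= M &
  forall e : R, 0 <= e -> hcover s (hurwitz_tail M 0) e%:E ->
    hcover s (hurwitz_tail M 0) (2^-1 * e)%:E.
Proof.
move=> s1; have [M M2 [t t0 [C C0 [tC hC hw]]]] := branch_weight s1.
exists M => // e e0 h; set u := riemannR _ in hC hw.
have u0 n : 0 <= u n by rewrite ltW // riemannR_gt0 //; lra.
pose A m n := if M <= cabs (gauss_enum m n)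
  then (fun w => (gauss_enum m n + w)^-1) @` hurwitz_tail M 0 else set0.
have hA m n : hcover s (A m n) ((t * u m * e)%:E * (u n)%:E)%E.
  rewrite /A; case: ifPn => [hM|_]; last first.
    apply: (hcover_le (@subset_refl _ _) _ (hcover_set0 s)).
    by rewrite lee_fin !mulr_ge0.
  apply: (hcover_le (@subset_refl _ _) _ (@hcover_lipschitz _ s
    (4 / cabs (gauss_enum m n) ^+ 2) _ (hurwitz_tail M 0) e%:E _ _ _ h)).
  - rewrite -EFinM lee_fin mulrAC ler_wpM2r //.
    exact: hw.
  - lra.
  - by rewrite divr_ge0 ?sqr_ge0.
  move=> x y [x1 _] [y1 _]; apply: branch_lipschitz => //.
  exact: le_trans hM.
apply: (hcover_le _ _ (hcover_bigcup2 hA)).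
  move=> z hz; have [m [n zE]] := gauss_round_enum z^-1.
  exists m => //; exists n => //.
  rewrite /A ifT; last by rewrite -zE; exact: (hz.2 0%N).
  exists (hurwitz_map z); last by rewrite -zE -hurwitz_branch.
  by apply: hurwitz_tail_map; exact: hurwitz_tail_weaken.
apply: (@le_trans _ _ (\sum_(0 <= m <oo) ((t * C * e)%:E * (u m)%:E))%E).
  apply: lee_nneseries => m _ *.
    by apply: nneseries_ge0 => n _ _; rewrite lee_fin !mulr_ge0.
  rewrite nneseriesZl => [|*]; last by rewrite lee_fin.
  apply: (@le_trans _ _ ((t * u m * e)%:E * C%:E)%E).
    by rewrite lee_wpmul2l // lee_fin !mulr_ge0.
  by rewrite -!EFinM lee_fin le_eqVlt; apply/orP; left; apply/eqP; ring.
rewrite nneseriesZl => [|*]; last by rewrite lee_fin.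
apply: (@le_trans _ _ ((t * C * e)%:E * C%:E)%E).
  by rewrite lee_wpmul2l // lee_fin !mulr_ge0.
by rewrite -EFinM lee_fin mulrAC ler_wpM2r.
Qed.

(** The halving is iterated from the trivial cover by the set itself, whose diameter is at most
    2. *)
Lemma hurwitz_tail0_null s : 1 < s ->
  exists2 M, 2 <= M & hnull s (hurwitz_tail M 0).
Proof.
move=> s1; have [M M2 hM] := hurwitz_tail_cover_half s1; exists M => // e e0.
have hk k : hcover s (hurwitz_tail M 0) (2 ^- k * 2 `^ s)%:E.
  elim: k => [|k IH].
    rewrite expr0 invr1 mul1r.
    apply: (hcover_le (@subset_refl _ _) _ (hcover_self s (hurwitz_tail M 0))).
    apply: diameter_pow_le => //; first lra.
    move=> x y [x1 _] [y1 _]; apply: (le_trans (cabsD _ _)); rewrite cabsN; lra.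
  have := hM _ _ IH; rewrite mulrA -invfM -exprS; apply.
  by rewrite mulr_ge0 ?powR_ge0 // invr_ge0 exprn_ge0.
pose k := Num.truncn (2 `^ s / e).
apply: (hcover_le (@subset_refl _ _) _ (hk k.+1)); rewrite lee_fin.
rewrite mulrC ler_pdivrMr ?exprn_gt0 // mulrC -ler_pdivrMr //.
have hs : 2 `^ s / e < k.+1%:R.
  by have /andP[] := truncn_itv (divr_ge0 (powR_ge0 2 s) (ltW e0)).
apply: (le_trans (ltW hs)); rewrite -natrX ler_nat.
exact/ltnW/ltn_expl.
Qed.

Lemma hnull_bigcup2 s (A : nat -> nat -> set R[i]) :
  (forall m n, hnull s (A m n)) -> hnull s (\bigcup_m \bigcup_n A m n).
Proof. by move=> h; apply: hnull_bigcup => m; exact: hnull_bigcup. Qed.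

(** A point of rank [k + 1] is [(a + w)^-1] with [w] of rank [k]. As [a] may be small here, the
    condition [|(a + w)^-1| <= 1] built into [B] is what makes the branch 1-Lipschitz. *)
Lemma hurwitz_tail_null s M k : 0 <= s -> 0 < M ->
  hnull s (hurwitz_tail M 0) -> hnull s (hurwitz_tail M k).
Proof.
move=> s0 M0 h0; elim: k => [//|k IH].
pose B m n := hurwitz_tail M k `&` [set w | gauss_enum m n + w != 0 /\
  cabs (gauss_enum m n + w)^-1 <= 1].
apply: (@hnull_sub _ _ _ (\bigcup_m \bigcup_n
    ((fun w => (gauss_enum m n + w)^-1) @` B m n))).
  move=> z hz; have [m [n zE]] := gauss_round_enum z^-1.
  exists m => //; exists n => //; exists (hurwitz_map z); last first.
    by rewrite -zE -hurwitz_branch.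
  split; first exact: hurwitz_tail_map.
  rewrite /= -zE -hurwitz_branch /hurwitz_map addrC subrK invr_eq0.
  by split; [exact: hurwitz_tail_neq0 hz|exact: hz.1].
apply: hnull_bigcup2 => m n; apply: (@hnull_lipschitz _ s 1) => //.
  move=> x y [_ [x0 x1]] [_ [y0 y1]]; rewrite mul1r cabs_invB //.
  rewrite (_ : _ + x - _ = x - y); last by ring.
  by rewrite ler_piMr ?cabs_ge0 // mulr_ile1 ?cabs_ge0.
by apply: hnull_sub IH => z [].
Qed.

(** The digits eventually have modulus at least [M]; there are countably many starting ranks and
    integer parts, and translations are isometries. *)
Lemma hcf_digits_to_infty_null s : 1 < s ->
  hnull s [set z : R[i] | cabs (hcf_digit z n) @[n --> \oo] --> +oo].
Proof.
move=> s1; have [M M2 h0] := hurwitz_tail0_null s1.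
apply: (@hnull_sub _ _ _ (\bigcup_k \bigcup_m \bigcup_n
    ((fun w => gauss_enum m n + w) @` hurwitz_tail M k))).
  move=> z /cvgryPge /(_ M)[k _ hk].
  have [m [n zE]] := gauss_round_enum z.
  exists k => //; exists m => //; exists n => //.
  exists (z - gauss_round z); last by rewrite -zE addrC subrK.
  split; first exact/ltW/gauss_round_dist_lt1.
  by move=> j kj; have := hk j.+1 (leqW kj).
apply: hnull_bigcup => k; apply: hnull_bigcup2 => m n.
apply: (@hnull_lipschitz _ s 1) => //; first lra.
  by move=> x y _ _; rewrite mul1r (_ : _ + x - _ = x - y) //; ring.
by apply: hurwitz_tail_null => //; lra.
Qed.

End UpperBound.

(** * Continued fractions with large digits *)

Section ContinuedFractions.
Variable R : realType.
Implicit Types (x e : R) (z w : R[i]) (a u : nat -> R[i]).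

Lemma le_geometric_eq0 x e : 0 <= x -> (forall m : nat, x <= e / 2 ^+ m) -> x = 0.
Proof.
move=> x0 h; apply/eqP; rewrite eq_le x0 andbT leNgt; apply/negP => xp.
have e0 : 0 <= e by have := h 0%N; rewrite expr0 divr1; exact: le_trans.
pose m := (Num.truncn (e / x)).+1.
have /andP[_ hs] := truncn_itv (divr_ge0 e0 x0).
have : e / x < 2 ^+ m.
  by apply: (lt_le_trans hs); rewrite -natrX ler_nat; exact/ltnW/ltn_expl.
rewrite ltr_pdivrMr // mulrC -ltr_pdivrMr ?exprn_gt0 // ltNge.
by rewrite h.
Qed.

(** The intervals of centre [v m] and radius [2 / 2 ^+ m] are nested; the supremum of their left
    ends lies in all of them. *)
Lemma geometric_limit (v : nat -> R) :
  (forall m, `|v m.+1 - v m| <= 2 ^- m) ->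
  exists l, forall m, `|l - v m| <= 2 / 2 ^+ m.
Proof.
move=> hv; pose lo m := v m - 2 / 2 ^+ m; pose hi m := v m + 2 / 2 ^+ m.
have half m : 2 / 2 ^+ m.+1 = 2 ^- m :> R.
  by rewrite exprS invfM mulrA divff // mul1r.
have p0 m : 0 < 2 ^- m :> R by rewrite invr_gt0 exprn_gt0.
have lo_homo : {homo lo : m n / (m <= n)%N >-> m <= n}.
  apply: homo_leq => [//|y x z|m]; first exact: le_trans.
  rewrite /lo half; have := hv m; rewrite ler_norml => /andP[h _].
  have := p0 m; lra.
have hi_homo : {homo hi : m n / (m <= n)%N >-> n <= m}.
  apply: (@homo_leq _ hi (fun x y => y <= x)) => [//|y x z h1 h2|m].
    exact: le_trans h2 h1.
  rewrite /hi half; have := hv m; rewrite ler_norml => /andP[_ h].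
  have := p0 m; lra.
have lohi m n : lo m <= hi n.
  apply: (@le_trans _ _ (lo (maxn m n))); first by apply: lo_homo; rewrite leq_maxl.
  apply: (@le_trans _ _ (hi (maxn m n))); last by apply: hi_homo; rewrite leq_maxr.
  by rewrite /lo /hi; have := p0 (maxn m n); lra.
have hs : has_sup (range lo).
  by split; [exists (lo 0%N); exists 0%N|exists (hi 0%N) => _ [m _ <-]].
exists (sup (range lo)) => m.
have h1 : lo m <= sup (range lo) by apply: ub_le_sup; [exact: hs.2|exists m].
have h2 : sup (range lo) <= hi m.
  by apply: ge_sup; [exact: hs.1|move=> _ [n _ <-]].
by rewrite ler_norml; move: h1 h2; rewrite /lo /hi => h1 h2; apply/andP; split; lra.
Qed.

Lemma complex_geometric_limit u :
  (forall m, cabs (u m.+1 - u m) <= 2 ^- m) ->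
  exists z, forall m, cabs (z - u m) <= 4 / 2 ^+ m.
Proof.
move=> hu.
have [x hx] : exists l, forall m, `|l - complex.Re (u m)| <= 2 / 2 ^+ m.
  apply: geometric_limit => m; apply: (le_trans _ (hu m)).
  by apply: (le_trans _ (Re_le_cabs _)); case: (u m.+1) (u m) => ? ? [].
have [y hy] : exists l, forall m, `|l - complex.Im (u m)| <= 2 / 2 ^+ m.
  apply: geometric_limit => m; apply: (le_trans _ (hu m)).
  by apply: (le_trans _ (Im_le_cabs _)); case: (u m.+1) (u m) => ? ? [].
exists (x +i* y) => m; apply: (le_trans (cabs_leD _)).
have -> : 4 / 2 ^+ m = 2 / 2 ^+ m + 2 / 2 ^+ m :> R by rewrite -mulrDl -natrD.
by have := lerD (hx m) (hy m); case: (u m).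
Qed.

(** The finite continued fraction [0; a_k, ..., a_(k+m-1)]. *)
Fixpoint convergent a (m k : nat) : R[i] :=
  if m is m'.+1 then (a k + convergent a m' k.+1)^-1 else 0.

Lemma cabs_digit_inv w z : 5 <= cabs w -> cabs z <= 2^-1 ->
  w + z != 0 /\ cabs (w + z)^-1 <= 4^-1.
Proof.
move=> w5 z1; have h := cabsD_ge w z; rewrite -cabs_gt0 cabsV.
have h4 : 4 <= cabs (w + z) by lra.
by split; [|rewrite lef_pV2 ?posrE]; lra.
Qed.

Lemma cabs_digit_contract w (x y : R[i]) :
  5 <= cabs w -> cabs x <= 2^-1 -> cabs y <= 2^-1 ->
  cabs ((w + x)^-1 - (w + y)^-1) <= 2^-1 * cabs (x - y).
Proof.
move=> w5 x1 y1; have [x0 hx] := cabs_digit_inv w5 x1.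
have [y0 hy] := cabs_digit_inv w5 y1.
rewrite cabs_invB // (_ : w + x - (w + y) = x - y); last by ring.
rewrite mulrC ler_wpM2r ?cabs_ge0 //.
by have := ler_pM (cabs_ge0 _) (cabs_ge0 _) hx hy; lra.
Qed.

(* [z n] is the value of the continued fraction [0; a_n, a_(n+1), ...]. *)
Definition cf_tails a (z : nat -> R[i]) := forall n,
  [/\ z n = (a n + z n.+1)^-1, z n != 0 & cabs (z n) <= 4^-1].

(** The convergents starting at [k] stay in the disc of radius 1/4 and approach each other
    geometrically; their recursion passes to the limit. *)
Lemma cf_tails_exists a :
  (forall n, 5 <= cabs (a n)) -> exists z : nat -> R[i], cf_tails a z.
Proof.
move=> a5.
have c1 m k : cabs (convergent a m k) <= 4^-1.
  elim: m k => [|m IH] k.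
    by rewrite -[convergent _ _ _]/(0 : R[i]) cabs0.
  suff /(cabs_digit_inv (a5 k))[] : cabs (convergent a m k.+1) <= 2^-1 by [].
  by have := IH k.+1; lra.
have c2 m k : cabs (convergent a m k) <= 2^-1 by have := c1 m k; lra.
have cS m k : cabs (convergent a m.+1 k - convergent a m k) <= 2 ^- m.
  elim: m k => [|m IH] k.
    by rewrite subr0 expr0 invr1; have := c1 1%N k; lra.
  apply: (le_trans (cabs_digit_contract (a5 k) (c2 m.+1 k.+1) (c2 m k.+1))).
  by rewrite exprS invfM ler_pM2l.
have /choice[z hz] : forall k, exists z, forall m,
    cabs (z - convergent a m k) <= 4 / 2 ^+ m.
  by move=> k; apply: complex_geometric_limit => m; exact: cS.
have z2 k : cabs (z k) <= 2^-1.
  (* At depth 4 the error [4 / 2 ^+ 4] is 1/4, which added to the bound [c1] gives 1/2. *)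
  have := cabsD (z k - convergent a 4 k) (convergent a 4 k); rewrite subrK.
  by have := hz k 4; have := c1 4 k; lra.
have zE k : z k = (a k + z k.+1)^-1.
  apply/eqP; rewrite -subr_eq0 -cabs_eq0; apply/eqP.
  (* Two errors of at most [2 / 2 ^+ m] each make up the constant 4. *)
  apply: (@le_geometric_eq0 _ 4); first exact: cabs_ge0.
  move=> m.
  have -> : z k - (a k + z k.+1)^-1 = (z k - convergent a m.+1 k) +
    ((a k + convergent a m k.+1)^-1 - (a k + z k.+1)^-1) by rewrite /=; ring.
  apply: (le_trans (cabsD _ _)).
  have h1 := cabs_digit_contract (a5 k) (c2 m k.+1) (z2 k.+1).
  have h2 := hz k m.+1; have h3 := hz k.+1 m.
  rewrite cabs_distC in h3; rewrite exprS invfM in h2.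
  apply: (le_trans (lerD h2 h1)); lra.
exists z => n; have [h1 h2] := cabs_digit_inv (a5 n) (z2 n.+1).
by split; rewrite ?[z n]zE // invr_eq0.
Qed.

(** The tails are below 1/2, so [(z n)^-1 = a n + z n.+1] rounds to [a n] and the Hurwitz map shifts
    the tails. *)
Lemma hcf_remainder_cf a (z : nat -> R[i]) (p q : nat -> int) :
  (forall n, a n = gauss_int R (p n) (q n)) ->
  cf_tails a z ->
  forall n, hcf_remainder (z 0%N) n = z n.
Proof.
move=> aE hz; have z1 n : cabs (z n) < 2^-1 by have [_ _] := hz n; lra.
elim=> [|n IH].
  have := @gauss_round_eq R 0 0 _ (z1 0%N); rewrite /gauss_int add0r.
  by rewrite /hcf_remainder /= => ->; rewrite subr0.
rewrite /hcf_remainder iterS -/(hcf_remainder _ _) IH /hurwitz_map.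
have [-> _ _] := hz n; rewrite invrK aE gauss_round_eq //.
by rewrite addrC addKr.
Qed.

Lemma hcf_digit_cf a (z : nat -> R[i]) (p q : nat -> int) :
  (forall n, a n = gauss_int R (p n) (q n)) ->
  cf_tails a z ->
  forall n, hcf_digit (z 0%N) n.+1 = a n.
Proof.
move=> aE hz n; rewrite /= (hcf_remainder_cf aE hz).
have [-> _ _] := hz n; rewrite invrK aE gauss_round_eq //.
by have [_ _] := hz n.+1; lra.
Qed.

Lemma cf_not_gauss_rational a (z : nat -> R[i]) (p q : nat -> int) :
  (forall n, a n = gauss_int R (p n) (q n)) ->
  cf_tails a z ->
  ~ gauss_rational (z 0%N).
Proof.
move=> aE hz /gauss_rational_orbit[j]; rewrite (hcf_remainder_cf aE hz).
by have [_ /eqP] := hz j.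
Qed.

End ContinuedFractions.

(** * Mixed radix expansions in [0, 1) *)

Section MixedRadix.
Variables (R : realType) (q : nat -> nat).
Hypothesis q2 : forall n, (2 <= q n)%N.
Implicit Types t : R.

(** What is left of [t] after [n] digits, rescaled to [0, 1). *)
Fixpoint radix_rest t (n : nat) : R :=
  if n is n'.+1 then (q n')%:R * radix_rest t n' -
    (Num.truncn ((q n')%:R * radix_rest t n'))%:R else t.

Definition radix_digit t (n : nat) : nat := Num.truncn ((q n)%:R * radix_rest t n).

Lemma radix_rest_itv t n : 0 <= t < 1 -> 0 <= radix_rest t n < 1.
Proof.
move=> t01; elim: n => [//|n /andP[IH _]] /=.
have := truncn_itv (mulr_ge0 (ler0n R (q n)) IH).
by rewrite subr_ge0 ltrBlDr [1 + _]addrC natr1.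
Qed.

Lemma radix_digit_lt t n : 0 <= t < 1 -> (radix_digit t n < q n)%N.
Proof.
move=> t01; have /andP[h0 h1] := radix_rest_itv n t01.
have /andP[h _] := truncn_itv (mulr_ge0 (ler0n R (q n)) h0).
rewrite -(ltr_nat R); apply: (le_lt_trans h).
by rewrite gtr_pMr // ltr0n (leq_trans _ (q2 n)).
Qed.

Lemma radix_restB t t' n :
  (forall i, (i < n)%N -> radix_digit t i = radix_digit t' i) ->
  radix_rest t n - radix_rest t' n = \prod_(i < n) (q i)%:R * (t - t').
Proof.
elim: n => [|n IH] h; first by rewrite big_ord0 mul1r.
have := h n (ltnSn n); rewrite /radix_digit /= => ->.
have := IH (fun i hi => h i (ltnW hi)).
rewrite big_ord_recr /= => e.
transitivity ((q n)%:R * (radix_rest t n - radix_rest t' n)); first by ring.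
by rewrite e; ring.
Qed.

Lemma radix_prod_gt0 n : 0 < \prod_(i < n) (q i)%:R :> R.
Proof. by apply: prodr_gt0 => i _; rewrite ltr0n (leq_trans _ (q2 i)). Qed.

(** Removing the common digits multiplies the difference by the product of the bases, and both rests
    lie in [0, 1). *)
Lemma radix_dist t t' n : 0 <= t < 1 -> 0 <= t' < 1 ->
  (forall i, (i < n)%N -> radix_digit t i = radix_digit t' i) ->
  `|t - t'| <= (\prod_(i < n) (q i)%:R)^-1.
Proof.
move=> t01 t01' h; have P0 := radix_prod_gt0 n.
rewrite -(ler_pM2l P0) divff ?gt_eqF // -[X in X * _](gtr0_norm P0) -normrM.
rewrite -(radix_restB h) ler_norml.
have /andP[? ?] := radix_rest_itv n t01; have /andP[? ?] := radix_rest_itv n t01'.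
by apply/andP; split; lra.
Qed.

Lemma radix_first_diff t t' : 0 <= t < 1 -> 0 <= t' < 1 -> t != t' ->
  exists n, (forall i, (i < n)%N -> radix_digit t i = radix_digit t' i) /\
    radix_digit t n <> radix_digit t' n.
Proof.
move=> t01 t01' tt'.
have [|h] := pselect (exists n, radix_digit t n != radix_digit t' n).
  move=> ex; exists (ex_minn ex); case: ex_minnP => m /eqP hm hmin; split => //.
  by move=> i im; apply/eqP/negPn/negP => /hmin; rewrite leqNgt im.
(* If all digits agreed, [radix_dist] with bases at least 2 would give [|t - t'| <= 2 ^- m] for
   every [m]. *)
exfalso; move/eqP: tt'; apply; apply/eqP; rewrite -subr_eq0 -normr_eq0; apply/eqP.
apply: (@le_geometric_eq0 _ _ 1) => // m.
apply: (le_trans (@radix_dist t t' m t01 t01' _)).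
  by move=> i _; apply/eqP/negPn/negP => hi; apply: h; exists i.
rewrite mul1r lef_pV2 ?posrE ?exprn_gt0 ?radix_prod_gt0 //.
rewrite -[X in _ ^+ X]card_ord -prodr_const ler_prod // => i _.
by rewrite ler0n ler_nat q2.
Qed.

End MixedRadix.

(** * Lower bound *)

Section LowerBound.
Variables (R : realType) (N0 : nat).
Hypothesis N05 : (5 <= N0)%N.
Implicit Types s t : R.

Definition box_size (n : nat) : nat := (N0 + n)%N.
Local Notation N := box_size.

Definition box_digit (n d : nat) : R[i] :=
  gauss_int R (N n + d %/ N n)%:Z (N n + d %% N n)%:Z.

Lemma box_size_ge5 n : (5 <= N n)%N.
Proof. by rewrite (leq_trans N05) // leq_addr. Qed.

Lemma box_digit_inj n d d' : box_digit n d = box_digit n d' -> d = d'.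
Proof.
move=> [] /eqP; rewrite eqr_int => /eqP[/addnI hq] /eqP.
rewrite eqr_int => /eqP[/addnI hr].
by rewrite (divn_eq d (N n)) hq hr -divn_eq.
Qed.

Lemma box_digit_ge n d : (N n)%:R <= cabs (box_digit n d).
Proof.
apply: (le_trans _ (Re_le_cabs _)); rewrite /= -[_%:~R]/(_%:R) normr_nat.
by rewrite ler_nat leq_addr.
Qed.

(** Both coordinates are below [2 N n], and [8 <= 3^2]. *)
Lemma box_digit_le n d : (d < N n ^ 2)%N -> cabs (box_digit n d) <= 3 * (N n)%:R.
Proof.
move=> hd; have N5 := box_size_ge5 n.
rewrite -(@ler_pXn2r _ 2) ?nnegrE ?cabs_ge0 ?mulr_ge0 // gauss_int_sqr.
have h1 : (d %/ N n < N n)%N by rewrite ltn_divLR ?mulnn //; lia.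
have h2 : (d %% N n < N n)%N by rewrite ltn_mod; lia.
rewrite -natrM -natrX.
rewrite -[_%:~R]/((((N n + d %/ N n) ^ 2 + (N n + d %% N n) ^ 2)%N)%:R).
rewrite ler_nat; nia.
Qed.

Lemma box_digit_sep n d d' : d <> d' -> 1 <= cabs (box_digit n d - box_digit n d').
Proof.
move=> dd'; have : box_digit n d - box_digit n d' != 0.
  by rewrite subr_eq0; apply/eqP => /box_digit_inj.
by rewrite /box_digit gauss_intB; exact: gauss_int_ge1.
Qed.

(** While the digits agree, going from rank [i + 1] to rank [i] multiplies the distance by
    [|z i| |z' i|], which is at least [1/(16 N_i^2)]. At the first disagreement the digits are at
    least 1 apart, and the tails, of modulus at most 1/4, take back at most 1/2. *)
Lemma cf_separation (d d' : nat -> nat) (z z' : nat -> R[i]) n :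
  (forall i, (d i < N i ^ 2)%N) -> (forall i, (d' i < N i ^ 2)%N) ->
  cf_tails (fun i => box_digit i (d i)) z ->
  cf_tails (fun i => box_digit i (d' i)) z' ->
  (forall i, (i < n)%N -> d i = d' i) -> d n <> d' n ->
  (2 * \prod_(i < n.+1) (16 * (N i ^ 2)%:R))^-1 <= cabs (z 0%N - z' 0%N).
Proof.
move=> hd hd' hz hz' hi hn.
have N0r i : 5 <= (N i)%:R :> R by rewrite ler_nat box_size_ge5.
have low (e : nat -> nat) (y : nat -> R[i]) i : (forall i, (e i < N i ^ 2)%N) ->
    cf_tails (fun i => box_digit i (e i)) y ->
    (4 * (N i)%:R)^-1 <= cabs (y i).
  move=> he hy; have [yE y0 _] := hy i; have [_ _ y1] := hy i.+1.
  have := y0; rewrite yE invr_eq0 => y0'; rewrite cabsV lef_pV2 ?posrE ?cabs_gt0 //.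
    apply: (le_trans (cabsD _ _)); have := box_digit_le (he i); have := N0r i; lra.
  by have := N0r i; lra.
have step i : cabs (z i - z' i) =
    cabs (box_digit i (d i) - box_digit i (d' i) + (z i.+1 - z' i.+1)) *
      (cabs (z i) * cabs (z' i)).
  have [zE z0 _] := hz i; have [zE' z0' _] := hz' i.
  rewrite {1}zE {1}zE' cabs_invB -?zE -?zE' //; first last.
  - by rewrite -invr_eq0 -zE'.
  - by rewrite -invr_eq0 -zE.
  by congr (cabs _ * _); ring.
have lows i : (16 * (N i ^ 2)%:R)^-1 <= cabs (z i) * cabs (z' i).
  have -> : (16 * (N i ^ 2)%:R)^-1 = (4 * (N i)%:R)^-1 * (4 * (N i)%:R)^-1 :> R.
    by rewrite natrX; field; have := N0r i; lra.
  apply: ler_pM; rewrite ?invr_ge0 ?mulr_ge0 //.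
    exact: low hd hz.
  exact: low hd' hz'.
have P0 i : 0 < 16 * (N i ^ 2)%:R :> R.
  by rewrite mulr_gt0 // ltr0n expn_gt0; have := box_size_ge5 i; lia.
have chain m : (m <= n)%N ->
    (\prod_(i < m) (16 * (N i ^ 2)%:R))^-1 * cabs (z m - z' m) <=
      cabs (z 0%N - z' 0%N).
  elim: m => [|m IH] hm; first by rewrite big_ord0 invr1 mul1r.
  apply: (le_trans _ (IH (ltnW hm))).
  rewrite big_ord_recr /= invfM -mulrA ler_wpM2l //.
    by rewrite invr_ge0 prodr_ge0 // => i _; exact: ltW.
  rewrite (step m) (hi m hm) subrr add0r mulrC ler_wpM2l ?cabs_ge0 //.
apply: (le_trans _ (chain n (leqnn n))).
rewrite big_ord_recr /= mulrCA invfM ler_wpM2l //.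
  by rewrite invr_ge0 prodr_ge0 // => i _; exact: ltW.
have half : 2^-1 <=
    cabs (box_digit n (d n) - box_digit n (d' n) + (z n.+1 - z' n.+1)).
  have h1 := @box_digit_sep n _ _ hn.
  have h2 := cabsD_ge (box_digit n (d n) - box_digit n (d' n)) (z n.+1 - z' n.+1).
  have h3 := cabsD (z n.+1) (- z' n.+1); rewrite cabsN in h3.
  have [_ _ h4] := hz n.+1; have [_ _ h5] := hz' n.+1.
  by lra.
by rewrite invfM (step n); apply: ler_pM; rewrite ?invr_ge0 ?(ltW (P0 n)).
Qed.

(** The left product has one factor more: that of rank 0 goes into the constant. As
    [N_(n+1) <= 2 N_n], the factor of rank [n + 1] is at most [64 N_n^2], whose power [s] is
    absorbed by rank [n] on the right. *)
Lemma box_prod_growth s n : 0 <= s ->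
  (forall i, (64 * (N i ^ 2)%:R) `^ s <= (N i ^ 2)%:R :> R) ->
  (2 * \prod_(i < n.+1) (16 * (N i ^ 2)%:R)) `^ s <=
    (2 * (16 * (N 0 ^ 2)%:R)) `^ s * \prod_(i < n) (N i ^ 2)%:R :> R.
Proof.
move=> s0 hN.
have P0 i : 0 <= 16 * (N i ^ 2)%:R :> R by rewrite mulr_ge0.
elim: n => [|n IH]; first by rewrite big_ord_recr !big_ord0 /= mul1r mulr1.
rewrite big_ord_recr /= mulrA powRM //; last first.
  by rewrite mulr_ge0 // prodr_ge0.
rewrite [in leRHS]big_ord_recr /= mulrA.
apply: ler_pM; rewrite ?powR_ge0 //.
apply: (le_trans _ (hN n)); rewrite ge0_ler_powR ?nnegrE ?mulr_ge0 //.
have h : (N n.+1 ^ 2 <= 4 * N n ^ 2)%N.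
  have : (N n.+1 <= 2 * N n)%N by have := box_size_ge5 n; rewrite /N; lia.
  by move=> h; rewrite -(expnMn 2 _ 2) leq_exp2r.
by move: h; rewrite -(ler_nat R) natrM; lra.
Qed.

Lemma holder_section s : 0 <= s ->
  (forall i, (64 * (N i ^ 2)%:R) `^ s <= (N i ^ 2)%:R :> R) ->
  exists2 K : R, 0 < K & exists g : R -> R[i],
  (forall t, 0 <= t < 1 -> ~ gauss_rational (g t) /\
    cabs (hcf_digit (g t) n) @[n --> \oo] --> +oo) /\
  (forall t t', 0 <= t < 1 -> 0 <= t' < 1 ->
    `|t - t'| <= K * cabs (g t - g t') `^ s).
Proof.
move=> s0 hN; pose q n := (N n ^ 2)%N.
have q2 n : (2 <= q n)%N.
  by rewrite /q -mulnn (leq_trans _ (leq_mul (box_size_ge5 n) (box_size_ge5 n))).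
pose dig (t : R) n := radix_digit q t n.
pose a (t : R) n := box_digit n (dig t n).
have a5 t n : 5 <= cabs (a t n).
  by apply: (le_trans _ (box_digit_ge _ _)); rewrite ler_nat box_size_ge5.
have /choice[z hz] := fun t => cf_tails_exists (a5 t).
have NN0 : (0 < N 0)%N by rewrite (leq_trans _ (box_size_ge5 0)).
exists ((2 * (16 * (N 0 ^ 2)%:R)) `^ s).
  by rewrite powR_gt0 // !mulr_gt0 // ltr0n expn_gt0 NN0.
exists (fun t => z t 0%N); split => [t t01|t t' t01 t01'].
  have aE n : a t n = gauss_int R (N n + dig t n %/ N n)%:Z
    (N n + dig t n %% N n)%:Z by [].
  split; first exact: (cf_not_gauss_rational aE (hz t)).
  (* The partial quotient [a t n] is the digit of index [n + 1], and its modulus is at least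
     [N0 + n > n]. *)
  apply/cvgryPge => A; exists (Num.truncn `|A|).+1 => // -[//|n] hn.
  rewrite (hcf_digit_cf aE (hz t)).
  apply: (le_trans _ (box_digit_ge _ _)); apply: (le_trans (ler_norm A)).
  have /andP[_ hA] := truncn_itv (normr_ge0 A).
  apply: (le_trans (ltW hA)); rewrite ler_nat /N.
  move: hn; rewrite /= ltnS => hn; apply: (leq_ltn_trans hn).
  by rewrite -{1}[n]add0n ltn_add2r (leq_trans _ N05).
have [<-|tt'] := eqVneq t t'; first by rewrite subrr normr0 mulr_ge0 ?powR_ge0.
have [n [heq hneq]] := radix_first_diff q2 t01 t01' tt'.
apply: (le_trans (radix_dist q2 t01 t01' heq)).
have sep := cf_separation (fun i => radix_digit_lt q2 i t01)
  (fun i => radix_digit_lt q2 i t01') (hz t) (hz t') heq hneq.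
have Q0 : 0 < 2 * \prod_(i < n.+1) (16 * (N i ^ 2)%:R) :> R.
  rewrite mulr_gt0 // prodr_gt0 // => i _.
  by rewrite mulr_gt0 // ltr0n (leq_trans _ (q2 i)).
have := box_prod_growth n s0 hN.
have P0 := radix_prod_gt0 R q2 n.
move=> h.
(* With [P] the product of the [q i], [Q] the inverse of the separation bound and [K] the constant,
   the growth lemma reads [Q^s <= K P], so [P^-1 <= K (Q^-1)^s]. *)
apply: (@le_trans _ _ ((2 * (16 * (N 0 ^ 2)%:R)) `^ s *
  ((2 * \prod_(i < n.+1) (16 * (N i ^ 2)%:R))^-1) `^ s)).
  rewrite -[in leRHS]powR_inv1 ?(ltW Q0) // -powRrM mulN1r powRN.
  rewrite -[leLHS]mul1r -(@ler_pM2r _ (\prod_(i < n) (q i)%:R)) // divfK ?gt_eqF //.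
  by rewrite mulrAC ler_pdivlMr ?powR_gt0 // mul1r.
rewrite ler_wpM2l ?powR_ge0 // ge0_ler_powR ?nnegrE ?cabs_ge0 ?invr_ge0 //.
exact: ltW.
Qed.

End LowerBound.

(** * Choice of the box sizes, and comparison with Lebesgue measure on [0, 1) *)

Section MassTransfer.
Variable R : realType.
Implicit Types s t : R.

(** With [n] the box size, the inequality amounts to [64^s <= (n^2)^(1-s)], that is [n^2 >= B];
    [s < 1] makes it true for all large [n]. *)
Lemma box_size_choice s : 0 <= s -> s < 1 -> exists2 N0, (5 <= N0)%N &
  forall i, (64 * (box_size N0 i ^ 2)%:R) `^ s <= (box_size N0 i ^ 2)%:R :> R.
Proof.
move=> s0 s1; pose B : R := (64 `^ s) `^ (1 - s)^-1.
have B0 : 0 <= B by exact: powR_ge0.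
have /andP[_ hB] := truncn_itv B0.
exists (5 + Num.truncn B)%N; first exact: leq_addr.
move=> i; set n := box_size _ _.
have nB : B <= (n ^ 2)%:R.
  apply: (le_trans (ltW hB)); rewrite ler_nat.
  have : ((Num.truncn B).+1 <= n)%N by rewrite /n /box_size; lia.
  by move=> h; rewrite (leq_trans h) // -mulnn leq_pmull // (leq_trans _ h).
have n0 : 0 < (n ^ 2)%:R :> R by rewrite ltr0n expn_gt0 /n /box_size; lia.
rewrite powRM ?(ltW n0) //.
have -> : 64 `^ s = B `^ (1 - s).
  by rewrite /B -powRrM mulVf ?powRr1 ?powR_ge0 //; lra.
have h : B `^ (1 - s) <= (n ^ 2)%:R `^ (1 - s).
  by rewrite ge0_ler_powR ?nnegrE ?(ltW n0) //; lra.
apply: (le_trans (ler_wpM2r (powR_ge0 _ _) h)).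
rewrite -powRD; last by rewrite (gt_eqF n0) implybT.
by rewrite subrK powRr1 ?(ltW n0).
Qed.

(* Pulling a cover of [A] back along [g] covers [0, 1) by sets of diameter at most
   [K diam^s]. *)
Lemma holder_section_measure s (K : R) (A : set R[i]) (g : R -> R[i]) :
  0 <= s -> 0 < K -> (forall t, 0 <= t < 1 -> A (g t)) ->
  (forall t t', 0 <= t < 1 -> 0 <= t' < 1 ->
    `|t - t'| <= K * cabs (g t - g t') `^ s) ->
  (0 < hausdorff_measure s A)%E.
Proof.
move=> s0 K0 gA gK.
apply: (@lt_le_trans _ _ ((2 * K)^-1)%:E); first by rewrite lte_fin invr_gt0 mulr_gt0.
(* A single mesh bounds the supremum from below; the value 1 serves to keep the diameters finite. *)
apply: (@le_trans _ _ (hausdorff_premeasure s 1 A)); last first.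
  by apply: ereal_sup_ubound; exists 1; rewrite //= ltr01.
apply: le_ereal_inf_tmp => _ [U [AU Ud] <-].
(* The pullback of [U k] may not be measurable, so it is enclosed in a closed interval centred at
   one of its points, of length [2 K diam^s]. *)
have /choice[V hV] : forall k, exists V : set (measurableTypeR R), [/\ measurable V,
    [set t | 0 <= t < 1 /\ U k (g t)] `<=` V &
    (lebesgue_measure V <= (2 * K)%:E * diameter_pow s (U k))%E].
  move=> k; have [->|/set0P[t0 [t01 Ut0]]] :=
      eqVneq [set t | 0 <= t < 1 /\ U k (g t)] set0.
    exists set0; split => //; rewrite measure0 mule_ge0 ?diameter_pow_ge0 //.
    by rewrite lee_fin mulr_ge0 ?ltW.
  have U0 : U k !=set0 by exists (g t0).
  move: (Ud k) (diameter_ge0 U0) (@le_diameter R (U k)).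
  rewrite /diameter_pow ifF; last exact/negbTE/set0P.
  case: (diameter (U k)) => [r| |] //= r1 r0 hr.
  rewrite lee_fin in r0.
  exists `[t0 - K * r `^ s, t0 + K * r `^ s]%classic; split => //.
    move=> t [t1 Ut]; rewrite /= in_itv /=.
    have h1 : `|t - t0| <= K * r `^ s.
      apply: (le_trans (gK _ _ t1 t01)); rewrite ler_pM2l //.
      rewrite ge0_ler_powR ?nnegrE ?cabs_ge0 //.
      by have := hr _ _ Ut Ut0; rewrite lee_fin.
    by move: h1; rewrite ler_norml => /andP[? ?]; apply/andP; split; lra.
  rewrite lebesgue_measure_itv /= lte_fin -EFinM.
  have Kr : 0 <= K * r `^ s by rewrite mulr_ge0 ?powR_ge0 ?ltW.
  by case: ifP => _; rewrite ?lee_fin -?EFinB ?lee_fin; lra.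
have : (lebesgue_measure (`[0%R, 1%R[%classic : set (measurableTypeR R)) <=
    \sum_(0 <= k <oo) lebesgue_measure (V k))%E.
  apply: measure_sigma_subadditive => //.
    by move=> k; have [] := hV k.
  move=> t; rewrite /= in_itv /= => t01; have [k _ Ukt] := AU _ (gA t t01).
  by exists k => //; have [_ + _] := hV k; apply.
rewrite lebesgue_measure_itv /= lte_fin ltr01 oppr0 adde0 => h1.
have h2 : (1 <= (2 * K)%:E * \sum_(0 <= k <oo) diameter_pow s (U k))%E.
  rewrite -nneseriesZl => [|*]; last exact: diameter_pow_ge0.
  apply: (le_trans h1); apply: lee_nneseries => k *; first exact: measure_ge0.
  by have [] := hV k.
rewrite -[leLHS]mule1 lee_pdivrMl // mulr_gt0 //.
Qed.

End MassTransfer.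

Theorem theorem1p3 (R : realType) :
  hausdorff_dim [set z : R[i] | ~ gauss_rational z /\
    cabs (hcf_digit z n) @[n --> \oo] --> +oo] = 1%:E.
Proof.
set E := [set z | _]; apply/eqP; rewrite eq_le; apply/andP; split.
  (* Every exponent [1 + e] gives measure zero, so the infimum is at most 1. *)
  apply/lee_addgt0Pr => e e0; apply: ereal_inf_lbound; exists (1 + e) => //=.
  split; first lra.
  apply: hnull_measure; first lra.
  apply: hnull_sub (@hcf_digits_to_infty_null R (1 + e) _); last lra.
  by move=> z [].
apply: le_ereal_inf_tmp => _ [s [s0 hs] <-]; rewrite lee_fin leNgt.
apply/negP => s1.
(* For an exponent below 1 the inverse-Hölder section [g] makes the measure positive, a
   contradiction. *)
have [N0 N05 hN] := box_size_choice s0 s1.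
have [K K0 [g [gE gK]]] := holder_section N05 s0 hN.
by have := @holder_section_measure _ _ _ E g s0 K0 gE gK; rewrite hs ltxx.
Qed.
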